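(* Let $\tau>0$, $\varphi>0$, $d_i\ge0$ and $\tilde\psi_i>0$ for $i=1,\dots,N$ with $\sum_i d_i>0$, and let $\pi_A>0$ be the equilibrium premium for parameters $(\varphi,(\tilde\psi_i)_i)$. For any $k>0$, consider the rescaled parameters $(k\varphi,(k\tilde\psi_i)_i)$, with $\tau$ and $(d_i)_i$ unchanged. Then the equilibrium premium for the rescaled parameters is $k\pi_A$; the Lambert-$W$ argument $d_i\pi\tau^2/\tilde\psi_i$ evaluated at equilibrium is unchanged for each $i$ (that is, $d_i(k\pi_A)\tau^2/(k\tilde\psi_i)=d_i\pi_A\tau^2/\tilde\psi_i$); and each equilibrium access intensity $\lambda_i^*$ and the equilibrium residual terminal demand $D_A$ are unchanged. In particular, halving $\varphi$ and all $\tilde\psi_i$ ($k=1/2$) halves the equilibrium premium exactly.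
   Context: There are finitely many operators $i=1,\dots,N$ with expected compliance shortfalls $d_i\ge0$ and normalized access-cost parameters $\tilde\psi_i>0$; $\tau>0$ is the cycle length. $W$ is the Lambert $W$ function on $[0,\infty)$, the inverse of $y\mapsto ye^y$ on $[0,\infty)$. For given parameters and $\pi\ge0$ define the access intensities and residual terminal demand $$\lambda_i^*(\pi)=\frac1\tau W\!\left(\frac{d_i\pi\tau^2}{\tilde\psi_i}\right),\qquad D_A(\pi)=\sum_i d_i e^{-\lambda_i^*(\pi)\tau}.$$ When $\sum_i d_i>0$, for each $\varphi>0$ the equation $\pi=\varphi D_A(\pi)$ has a unique positive solution $\pi_A$, called the equilibrium premium for the parameters $(\varphi,(\tilde\psi_i)_i)$. Equilibrium access intensities and residual terminal demand are $\lambda_i^*(\pi_A)$ and $D_A(\pi_A)$, computed with the corresponding $\tilde\psi_i$. *)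

(* Defs.v *)
From mathcomp Require Import all_boot all_order all_algebra.
From mathcomp Require Import all_classical all_reals all_analysis.
From mathcomp Require Import ring lra.
Import Order.TTheory GRing.Theory Num.Theory.
Import numFieldNormedType.Exports.

Set Implicit Arguments.
Unset Strict Implicit.
Unset Printing Implicit Defensive.

Local Open Scope classical_set_scope.
Local Open Scope ring_scope.

(* Outside [0, +oo[, where W is not defined, the value is the default 0. *)
Definition lambertW (R : realType) (x : R) : R :=
  xget 0 [set y | 0 <= y /\ y * expR y = x].

Definition lambertW_arg (R : realType) (N : nat) (tau : R)
    (d psi : 'I_N -> R) (p : R) (i : 'I_N) : R :=
  d i * p * tau ^+ 2 / psi i.

Definition access_intensity (R : realType) (N : nat) (tau : R)
    (d psi : 'I_N -> R) (p : R) (i : 'I_N) : R :=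
  tau^-1 * lambertW (lambertW_arg tau d psi p i).

Definition residual_demand (R : realType) (N : nat) (tau : R)
    (d psi : 'I_N -> R) (p : R) : R :=
  \sum_(i < N) d i * expR (- (access_intensity tau d psi p i * tau)).

(* The default 0 is never taken in the situation of interest: see
   [equilibrium_premiumP]. *)
Definition equilibrium_premium (R : realType) (N : nat) (tau : R)
    (d : 'I_N -> R) (phi : R) (psi : 'I_N -> R) : R :=
  xget 0 [set p | 0 < p /\ p = phi * residual_demand tau d psi p].

Lemma xexp_expand (R : realType) (a b : R) :
  0 <= a -> a <= b -> b - a <= b * expR b - a * expR a.
Proof.
move=> a0 ab.
have e1 : 1 <= expR a by have := expR_ge1Dx a; lra.
have e2 : expR a <= expR b by rewrite ler_expR.
by nra.
Qed.

Lemma lambertW_unique (R : realType) (y : R) :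
  0 <= y -> lambertW (y * expR y) = y.
Proof.
move=> y0; apply: xget_unique => // z [z0 zy].
have [zley|/ltW ylez] := leP z y.
- by have := xexp_expand z0 zley; lra.
- by have := xexp_expand y0 ylez; lra.
Qed.

Lemma lambertWP (R : realType) (x : R) : 0 <= x ->
  0 <= lambertW x /\ lambertW x * expR (lambertW x) = x.
Proof.
move=> x0; apply: (@xgetPex _ 0 [set y | 0 <= y /\ y * expR y = x]).
have cf : {within `[0, x], continuous (fun y : R => y * expR y)}.
  apply: continuous_subspaceT => y.
  by apply: cvgM; [exact: cvg_id | exact: continuous_expR].
have e1 : 1 <= expR x by have := expR_ge1Dx x; lra.
have [|y yI yx] := IVT x0 cf (v := x).
  by rewrite mul0r ge_min x0 le_max orbC /=; nra.
by exists y; split=> //; move: yI; rewrite in_itv /= => /andP[].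
Qed.

Lemma lambertW_lt0 (R : realType) (x : R) : x < 0 -> lambertW x = 0.
Proof.
move=> x0; apply: xgetPN => y [y0 yx].
have := mulr_ge0 y0 (expR_ge0 y); lra.
Qed.

Lemma lambertW_lip (R : realType) (x y : R) : x <= y ->
  lambertW x <= lambertW y <= lambertW x + (y - x).
Proof.
move=> xy.
have [y0|y0] := ltP y 0.
  by rewrite !lambertW_lt0 //; lra.
have [Wy0 Wy] := lambertWP y0.
have [x0|x0] := ltP x 0.
  rewrite (lambertW_lt0 x0) Wy0 /=.
  by have := xexp_expand (lexx 0) Wy0; lra.
have [Wx0 Wx] := lambertWP x0.
have [le|le] := orP (le_total (lambertW x) (lambertW y)).
- by have := xexp_expand Wx0 le; lra.
- by have := xexp_expand Wy0 le; lra.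
Qed.

Lemma continuous_lambertW (R : realType) : continuous (@lambertW R).
Proof.
move=> x; apply/cvgrPdist_le => e e0; near=> y.
have xye : `|x - y| <= e by near: y; exact: cvgr_dist_le.
apply: le_trans xye.
have [xy|/ltW yx] := leP x y.
- have /andP[h1 h2] := lambertW_lip xy.
  by rewrite !ler0_norm; lra.
- have /andP[h1 h2] := lambertW_lip yx.
  by rewrite !ger0_norm; lra.
Unshelve. all: by end_near. Qed.

Lemma residual_demand_nincr (R : realType) (N : nat) (tau : R)
    (d psi : 'I_N -> R) (p q : R) :
  0 < tau -> (forall i, 0 <= d i) -> (forall i, 0 < psi i) -> p <= q ->
  residual_demand tau d psi q <= residual_demand tau d psi p.
Proof.
move=> tau0 d0 psi0 pq; apply: ler_sum => i _.
apply: ler_wpM2l => //; rewrite ler_expR lerN2.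
apply: ler_wpM2r; first exact: ltW.
apply: ler_wpM2l; first by rewrite invr_ge0 ltW.
suff /lambertW_lip/andP[] :
  lambertW_arg tau d psi p i <= lambertW_arg tau d psi q i by [].
apply: ler_wpM2r; first by rewrite invr_ge0 ltW.
by apply: ler_wpM2r; [exact: sqr_ge0 | exact: ler_wpM2l].
Qed.

Lemma continuous_residual_demand (R : realType) (N : nat) (tau : R)
    (d psi : 'I_N -> R) : continuous (residual_demand tau d psi).
Proof.
apply: continuous_big => [|i _ p]; first exact: add_continuous.
apply: cvgM; first exact: cvg_cst.
apply: (@continuous_comp _ _ _ (fun x => - (access_intensity tau d psi x i * tau))
  (@expR R)); last exact: continuous_expR.
apply: cvgN; apply: cvgM; last exact: cvg_cst.
apply: cvgM; first exact: cvg_cst.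
apply: (@continuous_comp _ _ _ (fun x => lambertW_arg tau d psi x i));
  last exact: continuous_lambertW.
do 2 (apply: cvgM; last exact: cvg_cst).
by apply: cvgM; [exact: cvg_cst | exact: cvg_id].
Qed.

Lemma equilibrium_premiumP (R : realType) (N : nat) (tau : R)
    (d : 'I_N -> R) (phi : R) (psi : 'I_N -> R) :
  0 < tau -> 0 < phi -> (forall i, 0 <= d i) -> (forall i, 0 < psi i) ->
  0 < \sum_(i < N) d i ->
  let p := equilibrium_premium tau d phi psi in
  [/\ 0 < p, p = phi * residual_demand tau d psi p &
      forall q, 0 < q -> q = phi * residual_demand tau d psi q -> q = p].
Proof.
move=> tau0 phi0 d0 psi0 sd0.
have mono := residual_demand_nincr tau0 d0 psi0.
have uniq p q : p = phi * residual_demand tau d psi p ->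
    q = phi * residual_demand tau d psi q -> q = p.
  wlog pq : p q / p <= q.
    by move=> h hp hq; case: (leP p q) => [|/ltW] pq; [|symmetry]; exact: h.
  move=> hp hq; have := mono _ _ pq; nra.
have D0 : residual_demand tau d psi 0 = \sum_(i < N) d i.
  apply: eq_bigr => i _; rewrite /access_intensity /lambertW_arg.
  rewrite mulr0 !mul0r.
  have := @lambertW_unique R 0 (lexx 0); rewrite mul0r => ->.
  by rewrite mulr0 mul0r oppr0 expR0 mulr1.
pose M := phi * \sum_(i < N) d i.
have M0 : 0 < M by exact: mulr_gt0.
have cg : {within `[0, M], continuous
    (fun p => p - phi * residual_demand tau d psi p)}.
  apply: continuous_subspaceT => p; apply: cvgB; first exact: cvg_id.
  by apply: cvgM; [exact: cvg_cst | exact: continuous_residual_demand].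
have DM : phi * residual_demand tau d psi M <= M.
  by rewrite ler_wpM2l ?(ltW phi0) // -D0; apply: mono; exact: ltW.
have [|p pI /eqP] := IVT (ltW M0) cg (v := 0).
  by rewrite ge_min le_max D0 -/M sub0r oppr_le0 (ltW M0) /= subr_ge0 DM orbT.
rewrite subr_eq0 => /eqP hp.
have p0 : 0 < p.
  move: pI; rewrite in_itv /= => /andP[]; rewrite le_eqVlt => /orP[/eqP p0|//] _.
  by move: hp; rewrite -p0 D0 -/M; lra.
have [q0 hq] : [set p | 0 < p /\ p = phi * residual_demand tau d psi p]
    (equilibrium_premium tau d phi psi) by apply: xgetPex; exists p.
by split => // q _ hq'; exact: uniq.
Qed.

(* Main.v *)
Require Import Defs.
From mathcomp Require Import all_boot all_order all_algebra.
From mathcomp Require Import all_classical all_reals all_analysis.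
Import Order.TTheory GRing.Theory Num.Theory.
Local Open Scope ring_scope.


(* The Lambert-W argument depends on the premium and the access costs only
   through their ratio, so scaling both by [k] leaves the residual demand D_A
   unchanged; hence [k * piA] solves the rescaled fixed-point equation
   [p = (k * phi) * D_A p], and uniqueness of the equilibrium concludes. *)

Section Rescaling.
Variables (R : realType) (N : nat) (tau : R) (d psi : 'I_N -> R) (k : R).

Lemma lambertW_arg_rescale (p : R) (i : 'I_N) : k != 0 ->
  lambertW_arg tau d (fun j => k * psi j) (k * p) i = lambertW_arg tau d psi p i.
Proof.
(* Bring [k] to the front of the numerator, so that [mulrACA] can pair it with the [k^-1] split off
   from the denominator. *)
move=> k0; rewrite /lambertW_arg [d i * (k * p)]mulrCA -(mulrA k).
by rewrite invfM mulrACA divff // mul1r.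
Qed.

Lemma access_intensity_rescale (p : R) (i : 'I_N) : k != 0 ->
  access_intensity tau d (fun j => k * psi j) (k * p) i
  = access_intensity tau d psi p i.
Proof. by move=> k0; rewrite /access_intensity lambertW_arg_rescale. Qed.

Lemma residual_demand_rescale (p : R) : k != 0 ->
  residual_demand tau d (fun j => k * psi j) (k * p)
  = residual_demand tau d psi p.
Proof.
by move=> k0; apply: eq_bigr => i _; rewrite access_intensity_rescale.
Qed.

Lemma equilibrium_premium_rescale (phi : R) :
  0 < tau -> 0 < phi -> (forall i, 0 <= d i) -> (forall i, 0 < psi i) ->
  0 < \sum_(i < N) d i -> 0 < k ->
  equilibrium_premium tau d (k * phi) (fun i => k * psi i)
  = k * equilibrium_premium tau d phi psi.
Proof.
move=> tau0 phi0 d0 psi0 sd0 k0.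
have [p0 pE _] := equilibrium_premiumP tau0 phi0 d0 psi0 sd0.
(* Uniqueness is invoked for the rescaled parameters, so their positivity has to be supplied. *)
have kpsi0 i : 0 < k * psi i by exact: mulr_gt0.
have [_ _ uniq] :=
  equilibrium_premiumP tau0 (mulr_gt0 k0 phi0) d0 kpsi0 sd0.
symmetry; apply: uniq; first exact: mulr_gt0.
by rewrite residual_demand_rescale ?gt_eqF // -mulrA -pE.
Qed.

End Rescaling.

Theorem corollary4 (R : realType) (N : nat) (tau phi : R) (d psi : 'I_N -> R)
    (htau : 0 < tau) (hphi : 0 < phi)
    (hd : forall i : 'I_N, 0 <= d i) (hpsi : forall i : 'I_N, 0 < psi i)
    (hsum : 0 < \sum_(i < N) d i)
    (piA : R) (hpiA : piA = equilibrium_premium tau d phi psi) :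
  (forall k : R, 0 < k ->
    let piA' := equilibrium_premium tau d (k * phi) (fun i => k * psi i) in
    [/\ piA' = k * piA,
        forall i : 'I_N,
          lambertW_arg tau d (fun i => k * psi i) piA' i
            = lambertW_arg tau d psi piA i
          /\ d i * (k * piA) * tau ^+ 2 / (k * psi i)
            = d i * piA * tau ^+ 2 / psi i,
        forall i : 'I_N,
          access_intensity tau d (fun i => k * psi i) piA' i
            = access_intensity tau d psi piA i
      & residual_demand tau d (fun i => k * psi i) piA'
          = residual_demand tau d psi piA])
  /\ equilibrium_premium tau d (phi / 2) (fun i => psi i / 2) = piA / 2.
Proof.
split=> [k k0 piA'|].
  have kn0 : k != 0 by rewrite gt_eqF.
  have piA'E : piA' = k * piA by rewrite hpiA; exact: equilibrium_premium_rescale.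
  (* The rescaling identities hold at every premium, so they apply at [piA] in particular. *)
  rewrite piA'E; split=> // [i|i|].
  (* The explicit quotient is [lambertW_arg] unfolded, so one lemma closes both conjuncts by
     conversion. *)
  - by split; exact: lambertW_arg_rescale.
  - exact: access_intensity_rescale.
  - exact: residual_demand_rescale.
(* Halving is the case [k = 2^-1]; the cost function is first put in the form [k * psi i]. *)
have -> : (fun i => psi i / 2) = (fun i => 2^-1 * psi i).
  by apply/funext => i; rewrite mulrC.
rewrite hpiA (mulrC phi) [RHS]mulrC.
by apply: equilibrium_premium_rescale => //; rewrite invr_gt0.
Qed.
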